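(* Let $E$ be a linear space such as $\mathbb{R}^n$ or $\mathbb{R}^{m\times r}$ with inner product $\langle\cdot,\cdot\rangle_E$ and induced norm $\|\cdot\|_E$, let $\mathcal{M}=\{x\in E : \langle x,x\rangle_E-1=0\}$, and let $f:E\to\mathbb{R}$ be differentiable. Denote by $v_k=-\operatorname{grad} f(x_k)$ the anti-parallel direction of the Riemannian gradient of $f|_{\mathcal M}$ at $x_k\in\mathcal{M}$, and let $\mathcal{R}_{x_k}$ be the metric retraction onto $\mathcal{M}$, $\mathcal{R}_{x}(v)=\dfrac{x+v}{\|x+v\|_E}$. If a nonnegative $x_k$ is updated by $$x_{k+1}=\mathcal{R}_{x_k}(\alpha\odot v_k)$$ with the element-wise stepsize $\alpha=x_k\oslash\operatorname{grad}^+f(x_k)\in E$, then $x_{k+1}\ge 0$ and $x_{k+1}$ is on $\mathcal{M}$.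
   Context: $\odot$ and $\oslash$ denote element-wise product and element-wise division, and $\ge 0$ (nonnegativity) is understood element-wise. The Riemannian gradient is $\operatorname{grad} f(x)=\mathrm{proj}_{T_x\mathcal{M}}\nabla f(x)$, where $\nabla f$ is the Euclidean gradient in the standard basis, $T_x\mathcal{M}=\ker \mathrm{D}h(x)$ with $h(x)=\langle x,x\rangle_E-1$ is the tangent space of $\mathcal{M}$ at $x$, and $\mathrm{proj}_{T_x\mathcal{M}}$ is the orthogonal projection onto it (the manifold is endowed with the standard Euclidean metric). $\operatorname{grad}^+f(x_k)$ comes from an element-wise sign decomposition $\operatorname{grad} f(x_k)=\operatorname{grad}^+f(x_k)-\operatorname{grad}^-f(x_k)$ with $\operatorname{grad}^+f(x_k)\ge 0$ and $\operatorname{grad}^-f(x_k)\ge 0$; such a decomposition always exists, since any $b$ can be written $b=b^+-b^-$ with $b^+=\max(0,b)$, $b^-=\max(0,-b)$. The retraction formula is applied to $\alpha\odot v_k$ even though this vector need not be tangent to $\mathcal{M}$ at $x_k$.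
   Formalization: For an inner product other than the standard one, it is assumed that x_k + α⊙v_k ≠ 0, so that the retraction is defined (it can vanish otherwise); for the standard inner product this is proved. Entries of α where grad^+ f(x_k) is zero are set to 0. *)

(* Defs.v *)
From HB Require Import structures.
From mathcomp Require Import all_boot all_order all_algebra.
From mathcomp Require Import all_classical all_reals all_analysis.
Set Implicit Arguments.
Unset Strict Implicit.
Unset Printing Implicit Defensive.
Import Order.TTheory GRing.Theory Num.Theory.
Import numFieldNormedType.Exports.
Local Open Scope classical_set_scope.
Local Open Scope ring_scope.

(* The ambient space E is 'M[R]_(m, r); E = R^n is
   the case of one column.  Its topology comes from the max-norm, which in
   finite dimension gives the same notion of differentiability and the same
   derivatives as the norm of any inner product. *)
Section RiemannianMultiplicativeUpdate.
Variables (R : realType) (m r : nat).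
Local Notation E := 'M[R]_(m, r).
Implicit Types (ip : E -> E -> R) (f : E -> R) (x v u a b : E) (T : set E).

Definition mxhadamard a b : E := map2_mx *%R a b.

(* The inverse in R is total, with 0^-1 = 0: an entry is 0 wherever the
   divisor vanishes. *)
Definition mxhdiv a b : E := map2_mx (fun s t => s / t) a b.

Definition mxdot a b : R := \tr (a^T *m b).

Definition ipnorm ip x : R := Num.sqrt (ip x x).

Definition defining_fun ip x : R := ip x x - 1.

Definition ipsphere ip : set E := [set x | defining_fun ip x = 0].

Definition tangent_space ip x : set E :=
  [set v | 'd (defining_fun ip) x v = 0].

(* Orthogonality is with respect to the standard Euclidean metric.  The
   default value 0 is irrelevant when T is a linear subspace, for which the
   set below is a singleton. *)
Definition orth_proj T u : E :=
  xget 0 [set p | T p /\ forall w, T w -> mxdot (u - p) w = 0].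

Definition egrad f x : E := \matrix_(i, j) 'D_(delta_mx i j) f x.

Definition rgrad ip f x : E := orth_proj (tangent_space ip x) (egrad f x).

(* Meaningful for x + v != 0 only; takes the value 0 otherwise. *)
Definition metric_retraction ip x v : E := (ipnorm ip (x + v))^-1 *: (x + v).

End RiemannianMultiplicativeUpdate.

(* Main.v *)
(* Entrywise, x + alpha o v equals x gradm / gradp where gradp <> 0 and x where
   gradp = 0, so it is nonnegative, and normalising keeps it so.  For the
   standard inner product it cannot vanish: otherwise x o gradm = 0, hence
   <x, gradp> = <x, grad f> = 0 because grad f is tangent at x; thus
   x o gradp = 0 too, which forces every entry of x to be 0, against |x| = 1. *)
Require Import Defs.
From HB Require Import structures.
From mathcomp Require Import all_boot all_order all_algebra.
From mathcomp Require Import all_classical all_reals all_analysis.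
From mathcomp Require Import ring.
Set Implicit Arguments.
Unset Strict Implicit.
Unset Printing Implicit Defensive.
Import Order.TTheory GRing.Theory Num.Theory.
Import numFieldNormedType.Exports.
Local Open Scope classical_set_scope.
Local Open Scope ring_scope.

Lemma mxdotE (R : realType) (m r : nat) (a b : 'M[R]_(m, r)) :
  mxdot a b = \sum_j \sum_i a i j * b i j.
Proof.
rewrite /mxdot /mxtrace; apply: eq_bigr => j _; rewrite mxE.
by apply: eq_bigr => i _; rewrite mxE.
Qed.

Lemma is_diff_sum (R : numFieldType) (V W : normedModType R) (I : Type)
    (s : seq I) (f df : I -> V -> W) (x : V) :
  (forall i, is_diff x (f i) (df i)) ->
  is_diff x (\sum_(i <- s) f i) (\sum_(i <- s) df i).
Proof.
move=> dfx; elim/big_ind2: _ => [|f1 df1 f2 df2|i _]; last exact: dfx.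
  exact: is_diff_cst.
exact: is_diffD.
Qed.

Lemma is_diff_coord_sqr (R : realType) (m r : nat) (x : 'M[R]_(m, r)) i j :
  is_diff x (fun y : 'M[R]_(m, r) => y i j * y i j : R)
            (fun v => 2 * (x i j * v i j)).
Proof.
set c := fun y : 'M[R]_(m, r) => y i j : R.
have lin_c : linear c by move=> k u v; rewrite /c !mxE.
(* The coordinate map is packed as a linear map so that, being continuous, it is its own
   differential. *)
pose cM := GRing.isLinear.Build _ _ _ _ _ lin_c.
pose cL : {linear 'M[R]_(m, r) -> R} := HB.pack c cM.
have dc : is_diff x c c.
  apply: DiffDef; first exact: differentiable_coord.
  exact: (@diff_lin _ _ _ cL x (@coord_continuous _ _ _ i j)).
apply: is_diff_eq (is_diffM dc dc) _.
by apply/funext => v; rewrite mulr_natl mulr2n.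
Qed.

(** This turns tangency at [x], for the standard inner product, into orthogonality to [x]. *)
Lemma diff_mxdot_sphere (R : realType) (m r : nat) (x v : 'M[R]_(m, r)) :
  'd (defining_fun (@mxdot R m r)) x v = 2 * mxdot x v.
Proof.
have -> : defining_fun (@mxdot R m r) =
    \sum_j \sum_i (fun y : 'M[R]_(m, r) => y i j * y i j) - cst 1.
  apply/funext => y; rewrite /defining_fun mxdotE !fctE fct_sumE.
  by congr (_ - _); apply: eq_bigr => j _; rewrite fct_sumE.
have := is_diffB (is_diff_sum (index_enum 'I_r) (fun j =>
  is_diff_sum (index_enum 'I_m) (fun i => is_diff_coord_sqr x i j)))
  (is_diff_cst (1 : R) x).
move=> /@diff_val ->.
rewrite subr0 mxdotE fct_sumE mulr_sumr; apply: eq_bigr => j _.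
by rewrite fct_sumE mulr_sumr.
Qed.

(* When no orthogonal projection exists, [rgrad] is the default value 0, which
   is tangent as well. *)
Lemma rgrad_tangent (R : realType) (m r : nat)
    (ip : 'M[R]_(m, r) -> 'M[R]_(m, r) -> R) f (x : 'M[R]_(m, r)) :
  tangent_space ip x (rgrad ip f x).
Proof.
rewrite /rgrad /orth_proj; case: xgetP => [p _ [] //|_].
by rewrite /tangent_space /= linear0.
Qed.

Section UpdateEntries.
Variables (R : realFieldType) (s p q : R).
Hypotheses (s_ge0 : 0 <= s) (p_ge0 : 0 <= p) (q_ge0 : 0 <= q).

(** [s], [p], [q] stand for matching entries of [x], [gradp], [gradm]. If [p = 0], the convention
    [0^-1 = 0] makes the step vanish; otherwise the two copies of [s] cancel. *)
Lemma update_entryE :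
  s + s / p * - (p - q) = if p == 0 then s else s * q / p.
Proof.
have [->|p0] := eqVneq p 0; first by rewrite invr0 mulr0 mul0r addr0.
by field.
Qed.

Lemma update_entry_ge0 : 0 <= s + s / p * - (p - q).
Proof.
by rewrite update_entryE; case: ifP => // _; rewrite divr_ge0 ?mulr_ge0.
Qed.

Lemma update_entry_eq0 : s + s / p * - (p - q) = 0 -> s * q = 0.
Proof.
rewrite update_entryE; have [_ ->|p0 /eqP] := eqVneq p 0.
  by rewrite mul0r.
by rewrite mulf_eq0 invr_eq0 (negPf p0) orbF => /eqP.
Qed.

(** The assumptions force [p = 0], and there the update leaves [s] unchanged. *)
Lemma update_entry_neq0 :
  s != 0 -> s * p = 0 -> s + s / p * - (p - q) != 0.
Proof.
by move=> s0 /eqP; rewrite mulf_eq0 (negPf s0) /= update_entryE => ->.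
Qed.

End UpdateEntries.

Lemma mxdot_eq0_ge0 (R : realType) (m r : nat) (a b : 'M[R]_(m, r)) :
  a \is a mxOver Num.nneg -> b \is a mxOver Num.nneg ->
  mxdot a b = 0 -> forall i j, a i j * b i j = 0.
Proof.
move=> /mxOverP a_ge0 /mxOverP b_ge0 + i j; rewrite mxdotE => ab0.
have ab_ge0 k l : 0 <= a k l * b k l.
  by apply: mulr_ge0; [apply: a_ge0 | apply: b_ge0].
(* A vanishing sum of nonnegative terms has only zero terms: first for the column sums, then within
   column [j]. *)
have /psumr_eq0P/(_ j isT) := ab0.
move=> /(_ (fun l _ => sumr_ge0 _ (fun k _ => ab_ge0 k l))).
by move=> /psumr_eq0P -> // k _.
Qed.

Lemma ipsphere_neq0 (R : realType) (m r : nat)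
    (ip : {dot 'M[R]_(m, r) for idfun}) (x : 'M[R]_(m, r)) :
  ipsphere ip x -> x != 0.
Proof.
move=> /eqP; rewrite /defining_fun subr_eq0; apply: contraTneq => ->.
by rewrite linear0r eq_sym oner_eq0.
Qed.

(** By positive definiteness [ip y y] is positive, so it equals the square of [ipnorm ip y] and
    cancels against the two scalar factors. *)
Lemma ipsphere_normalize (R : realType) (m r : nat)
    (ip : {dot 'M[R]_(m, r) for idfun}) (y : 'M[R]_(m, r)) :
  y != 0 -> ipsphere ip ((ipnorm ip y)^-1 *: y).
Proof.
move=> /(@neq0_dnorm_gt0 _ _ _ ip) y_gt0.
rewrite /ipsphere /defining_fun /= linearZl_LR linearZr_LR /= mulrA -invfM -expr2.
by rewrite sqr_sqrtr ?ltW// mulVf ?subrr// gt_eqF.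
Qed.

Lemma mxdot_update_neq0 (R : realType) (m r : nat)
    (x gradp gradm : 'M[R]_(m, r)) :
  x != 0 -> x \is a mxOver Num.nneg -> gradp \is a mxOver Num.nneg ->
  mxdot x (gradp - gradm) = 0 ->
  x + mxhadamard (mxhdiv x gradp) (- (gradp - gradm)) != 0.
Proof.
move=> x_neq0 x_ge0 gradp_ge0 x_grad.
apply: contra_neq x_neq0 => y0.
have y0E i j :
    x i j + x i j / gradp i j * - (gradp i j - gradm i j) = 0.
  by move/matrixP: y0 => /(_ i j); rewrite !mxE.
have xm0 i j := update_entry_eq0 (y0E i j).
(* Since every product of entries of [x] and [gradm] is zero, the orthogonality hypothesis only
   retains [gradp]. *)
have xp0 : mxdot x gradp = 0.
  rewrite -[RHS]x_grad !mxdotE; apply: eq_bigr => j _; apply: eq_bigr => i _.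
  by rewrite !mxE mulrBr xm0 subr0.
apply/matrixP => i j; rewrite mxE; apply/eqP; apply: contraT => xij_neq0.
have := mxdot_eq0_ge0 x_ge0 gradp_ge0 xp0 i j.
by move=> /(update_entry_neq0 (gradm i j) xij_neq0) /eqP; rewrite y0E.
Qed.

Theorem proposition2 (R : realType) (m r : nat)
    (ip : {dot 'M[R]_(m, r) for idfun})
    (f : 'M[R]_(m, r) -> R) (f_diff : forall y, differentiable f y)
    (x : 'M[R]_(m, r)) (x_M : ipsphere ip x) (x_ge0 : x \is a mxOver Num.nneg)
    (gradp gradm : 'M[R]_(m, r))
    (gradp_ge0 : gradp \is a mxOver Num.nneg)
    (gradm_ge0 : gradm \is a mxOver Num.nneg)
    (grad_decomp : rgrad ip f x = gradp - gradm)
    (v alpha x' : 'M[R]_(m, r))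
    (v_def : v = - rgrad ip f x)
    (alpha_def : alpha = mxhdiv x gradp)
    (* For the standard inner product nothing is assumed here; for any other
       one, alpha o v must lie in the domain of the retraction at x. *)
    (retraction_dom : (forall a b, ip a b = mxdot a b)
                      \/ x + mxhadamard alpha v != 0)
    (x'_def : x' = metric_retraction ip x (mxhadamard alpha v)) :
  x' \is a mxOver Num.nneg /\ ipsphere ip x'.
Proof.
set y := x + mxhadamard alpha v.
have y_ge0 i j : 0 <= y i j.
  rewrite /y alpha_def v_def grad_decomp !mxE.
  apply: update_entry_ge0; [exact: (mxOverP x_ge0)
    | exact: (mxOverP gradp_ge0) | exact: (mxOverP gradm_ge0)].
have y_neq0 : y != 0.
  case: retraction_dom => // ip_std.
  rewrite /y alpha_def v_def grad_decomp.
  apply: mxdot_update_neq0 => //; first exact: ipsphere_neq0 x_M.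
  have := rgrad_tangent ip f x; rewrite grad_decomp /tangent_space /=.
  (* Equality as functions is required here, since [ip] occurs inside the map being
     differentiated. *)
  have -> : (ip : _ -> _ -> R) = @mxdot R m r.
    by apply/funext => a; apply/funext => b; exact: ip_std.
  rewrite diff_mxdot_sphere => /eqP.
  by rewrite mulf_eq0 pnatr_eq0 => /eqP.
rewrite x'_def /metric_retraction -/y; split; last exact: ipsphere_normalize.
by apply/mxOverP => i j; rewrite mxE nnegrE mulr_ge0 ?invr_ge0 ?sqrtr_ge0.
Qed.
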